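(* There exists a function $f\in\bigcap_{\alpha\in(0,1)}C^{0,\alpha}([0,1])$ which does not have the relaxed Sard property, i.e. $f_\#(\mathbf{1}_S\mathcal{L}^1)$ is not mutually singular with $\mathcal{L}^1$, where $S$ is the critical set of $f$.
   Context: $C^{0,\alpha}([0,1])$ is the space of $\alpha$-Hölder continuous real functions on $[0,1]$. $\mathcal{L}^1$ denotes Lebesgue measure on $\mathbb{R}$, $\mathbf{1}_A$ the indicator function of $A$, and $f_\#\mu$ the pushforward of the measure $\mu$ under $f$. The critical set $S$ of $f$ is the set of all points $x\in[0,1]$ at which $f$ is either not differentiable or has $f'(x)=0$. *)

(* Defs.v *)
From HB Require Import structures.
From mathcomp Require Import all_boot all_order all_algebra.
From mathcomp Require Import all_classical all_reals all_analysis.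
Set Implicit Arguments. Unset Strict Implicit. Unset Printing Implicit Defensive.
Import Order.TTheory GRing.Theory Num.Theory.
Import numFieldNormedType.Exports.
Local Open Scope classical_set_scope.
Local Open Scope ring_scope.

Definition holder_on01 {R : realType} (alpha : R) (f : R -> R) : Prop :=
  exists C : R, forall x y : R, x \in `[0, 1] -> y \in `[0, 1] ->
    `|f x - f y| <= C * (`|x - y| `^ alpha).

Definition critical_set {R : realType} (f : R -> R) : set R :=
  [set x | x \in `[0, 1] /\ (~ derivable f x 1 \/ derive1 f x = 0)].

Definition push_restr {R : realType} (f : R -> R) (S : set R) (B : set R) : \bar R :=
  (@lebesgue_measure R) (S `&` f @^-1` B).

Definition mutually_singular {R : realType} (mu nu : set R -> \bar R) : Prop :=
  exists A : set R, measurable A /\ mu A = 0%E /\ nu (~` A) = 0%E.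

(* Main.v *)
Require Import Defs.
From HB Require Import structures.
From mathcomp Require Import all_boot all_order all_algebra.
From mathcomp Require Import all_classical all_reals all_analysis.
From mathcomp Require Import lra ring zify.
Import Order.TTheory GRing.Theory Num.Theory.
Import numFieldNormedType.Exports.
Local Open Scope classical_set_scope.
Local Open Scope ring_scope.

(** Let [zigzag] be the continuous map of slopes 3, -3, 3 on the successive
    thirds of every interval [[j, j + 1]], which it maps onto itself covering
    it three times; it preserves Lebesgue measure, and so does its rescaling
    [zigzag_scaled M] to cells of length [1 / M].  The function is the limit of
    the compositions of [zigzag_scaled (3 ^+ (m ^ 2))] for [m = 1, ..., n].
    The [n]-th composition is [3 ^+ n]-Lipschitz with slope exactly
    [+/- 3 ^+ n] on its cells, whose endpoints are fixed by all later factors.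
    Hence the limit is nowhere differentiable and its critical set is [[0, 1]];
    since the cell lengths decay faster than any [3 ^- (C * n)], it is Hölder
    of every exponent below 1; and null sets have null preimages, so that a
    separating set would make [[0, 1]] null. *)

(** * The zigzag on unit cells *)

Section Zigzag.
Context {R : realType}.
Implicit Types (x y t M : R) (j k : int).

Definition tooth t : R :=
  if t <= 1 / 3 then 3 * t else if t <= 2 / 3 then 2 - 3 * t else 3 * t - 2.

Definition zigzag x : R :=
  (Num.floor x)%:~R + tooth (x - (Num.floor x)%:~R).

Definition zigzag_scaled M x : R := zigzag (M * x) / M.

(** At the right end the floor jumps to [j + 1], but [tooth 1 = 1] and [tooth 0 = 0] make both
    formulas agree; closed cells can therefore share endpoints. *)
Lemma zigzagE j x : j%:~R <= x <= j%:~R + 1 ->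
  zigzag x = j%:~R + tooth (x - j%:~R).
Proof.
move=> /andP[jx]; rewrite le_eqVlt => /orP[/eqP ->|xj].
  have fl : Num.floor (j%:~R + 1 : R) = j + 1.
    by apply: floor_def; rewrite !intrD; lra.
  rewrite /zigzag fl intrD /tooth; have -> : 1%:~R = 1 :> R by [].
  by do ![case: ifPn => ?]; lra.
rewrite /zigzag (_ : Num.floor x = j)//.
by apply: floor_def; rewrite intrD; lra.
Qed.

Lemma floor_bounds x :
  (Num.floor x)%:~R <= x <= (Num.floor x)%:~R + 1.
Proof.
rewrite floor_le/= ltW//.
by have := floorD1_gt x; rewrite intrD.
Qed.

Lemma zigzag_int j : zigzag j%:~R = j%:~R.
Proof.
rewrite (zigzagE j); last by lra.
by rewrite subrr /tooth; case: ifPn; lra.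
Qed.

Lemma zigzag_unit_cell j x : j%:~R <= x <= j%:~R + 1 ->
  j%:~R <= zigzag x <= j%:~R + 1.
Proof.
by move=> jx; rewrite (zigzagE _ _ jx) /tooth; do ![case: ifPn => ?]; lra.
Qed.

Lemma zigzag_dist_id x : `|zigzag x - x| <= 1.
Proof.
have fx := floor_bounds x; have := zigzag_unit_cell _ _ fx.
by rewrite ler_norml; lra.
Qed.

Lemma zigzag_lipschitz x y : `|zigzag x - zigzag y| <= 3 * `|x - y|.
Proof.
wlog xy : x y / x <= y.
  move=> H; have [/H//|/ltW/H] := leP x y.
  by rewrite distrC (distrC y).
have fx := floor_bounds x; have fy := floor_bounds y.
rewrite (@ler0_norm _ (x - y)); last by lra.
rewrite (zigzagE _ _ fx) (zigzagE _ _ fy).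
have := le_floor xy; rewrite le_eqVlt => /orP[/eqP e|].
  by move: fx fy; rewrite e ler_norml /tooth; do ![case: ifPn => ?]; lra.
(* In distinct cells, the offsets [t] of [x] and [s] of [y] satisfy [1 - tooth t <= 3 * (1 - t)] and
   [tooth s <= 3 * s]; whole cells in between contribute slope 1. *)
rewrite -lezD1 -(ler_int R) intrD; move: fx fy.
by rewrite ler_norml /tooth; do ![case: ifPn => ?]; lra.
Qed.

Lemma zigzag_third_expand k x y :
  k%:~R <= 3 * x <= k%:~R + 1 -> k%:~R <= 3 * y <= k%:~R + 1 ->
  `|zigzag x - zigzag y| = 3 * `|x - y|.
Proof.
move=> kx ky.
(* The third numbered [k] lies in the unit cell [j], and its residue mod 3 selects the affine branch
   of [tooth]. *)
pose j := (k %/ 3)%Z; have kE := divz_eq k 3; rewrite -/j in kE.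
have r3 : [|| k %% 3 == 0, k %% 3 == 1 | k %% 3 == 2]%Z by lia.
set r := (k %% 3)%Z in kE r3.
have kR : k%:~R = 3 * j%:~R + r%:~R :> R by rewrite {1}kE intrD intrM; ring.
have rR : [\/ r%:~R = 0 :> R, r%:~R = 1 :> R | r%:~R = 2 :> R].
  by case/or3P: r3 => /eqP ->; [apply: Or31|apply: Or32|apply: Or33].
have jx : j%:~R <= x <= j%:~R + 1 by case: rR => h; lra.
have jy : j%:~R <= y <= j%:~R + 1 by case: rR => h; lra.
rewrite (zigzagE _ _ jx) (zigzagE _ _ jy) /tooth.
have -> : 3 * `|x - y| = `|3 * (x - y)| by rewrite normrM ger0_norm.
case: rR => h; do ![case: ifPn => ?].
all: first [congr `|_|; lra | rewrite distrC; congr `|_|; lra].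
Qed.

(** Keeping the two images in a common cell is what lets the expansion be iterated along
    compositions. *)
Lemma zigzag_third_cell k x y :
  k%:~R <= 3 * x <= k%:~R + 1 -> k%:~R <= 3 * y <= k%:~R + 1 ->
  exists j, (j%:~R <= zigzag x <= j%:~R + 1) /\ (j%:~R <= zigzag y <= j%:~R + 1).
Proof.
move=> kx ky.
pose j := (k %/ 3)%Z; have kE := divz_eq k 3; rewrite -/j in kE.
have r3 : (0 <= k - 3 * j) && (k - 3 * j <= 2) by lia.
move: r3; rewrite -!(ler_int R) !intrD !intrN intrM => r3.
by exists j; split; apply: zigzag_unit_cell; lra.
Qed.

End Zigzag.

(** * Rescaling to cells of length [1 / M], and nesting of grids *)

Section Scaled.
Context {R : realType} (M : R).
Hypothesis M0 : 0 < M.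
Implicit Types (x y : R) (j k : int).

Lemma zigzag_scaled_lipschitz x y :
  `|zigzag_scaled M x - zigzag_scaled M y| <= 3 * `|x - y|.
Proof.
rewrite /zigzag_scaled -mulrBl normrM [X in _ * X]gtr0_norm ?invr_gt0//.
rewrite ler_pdivrMr// (le_trans (zigzag_lipschitz _ _))//.
by rewrite -mulrBr normrM (gtr0_norm M0) (mulrC M) mulrA.
Qed.

Lemma zigzag_scaled_dist_id x : `|zigzag_scaled M x - x| <= M^-1.
Proof.
rewrite /zigzag_scaled -[X in _ - X](mulfK (lt0r_neq0 M0)) -mulrBl normrM.
rewrite [X in _ * X]gtr0_norm ?invr_gt0// ler_piMl ?invr_ge0 ?(ltW M0)//.
by rewrite (mulrC x) zigzag_dist_id.
Qed.

Lemma zigzag_scaled_fix j x : M * x = j%:~R -> zigzag_scaled M x = x.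
Proof.
by move=> xj; rewrite /zigzag_scaled xj zigzag_int -xj mulrC mulKf ?gt_eqF.
Qed.

Lemma zigzag_scaled_expand k x y :
  k%:~R <= 3 * M * x <= k%:~R + 1 -> k%:~R <= 3 * M * y <= k%:~R + 1 ->
  `|zigzag_scaled M x - zigzag_scaled M y| = 3 * `|x - y|.
Proof.
rewrite -!mulrA => kx ky; rewrite /zigzag_scaled -mulrBl normrM.
rewrite (zigzag_third_expand _ _ _ kx ky) -mulrBr normrM normfV.
by rewrite (mulrC `|M|) mulrA mulfK// normr_eq0 gt_eqF.
Qed.

Lemma zigzag_scaled_cell k x y :
  k%:~R <= 3 * M * x <= k%:~R + 1 -> k%:~R <= 3 * M * y <= k%:~R + 1 ->
  exists j, (j%:~R <= M * zigzag_scaled M x <= j%:~R + 1) /\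
            (j%:~R <= M * zigzag_scaled M y <= j%:~R + 1).
Proof.
rewrite -!mulrA => kx ky; have [j jxy] := zigzag_third_cell _ _ _ kx ky.
by exists j; rewrite /zigzag_scaled ![M * (_ / M)]mulrC !divfK ?gt_eqF.
Qed.

End Scaled.

(** By integrality [j + 1 <= D * (j %/ D + 1)], so a cell of the [D] times finer grid has no integer
    in its interior. *)
Lemma coarser_cell {R : realType} (D : nat) (j : int) (u v : R) : (0 < D)%N ->
  j%:~R <= D%:R * u <= j%:~R + 1 -> j%:~R <= D%:R * v <= j%:~R + 1 ->
  exists k : int, (k%:~R <= u <= k%:~R + 1) /\ (k%:~R <= v <= k%:~R + 1).
Proof.
move=> D0 ju jv; exists (j %/ D)%Z.
have D0R : 0 < D%:R :> R by rewrite ltr0n.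
have h1 : D%:Z * (j %/ D)%Z <= j by rewrite mulrC lez_floor ?gt_eqF.
have h2 : j + 1 <= D%:Z * ((j %/ D)%Z + 1).
  by rewrite lezD1 mulrC ltz_ceil.
move: h1 h2; rewrite -!(ler_int R) !(intrD, intrM) -!pmulrn => h1 h2.
by split; apply/andP; split; rewrite -(ler_pM2l D0R); lra.
Qed.

(** * Finite compositions *)

Section Iterates.
Context {R : realType}.
Implicit Types (x y : R) (k : int) (n m : nat).

(** The newest and finest factor acts first, so one more step only perturbs the argument of the
    previous composition, by at most the new cell length. *)
Fixpoint zigzag_iter n : R -> R :=
  if n is m.+1 then zigzag_iter m \o zigzag_scaled (3 ^+ (m.+1 ^ 2)) else id.

Lemma zigzag_iterS n x : zigzag_iter n.+1 x =
  zigzag_iter n (zigzag_scaled (3 ^+ (n.+1 ^ 2)) x).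
Proof. by []. Qed.

Lemma zigzag_iter_lipschitz n x y :
  `|zigzag_iter n x - zigzag_iter n y| <= 3 ^+ n * `|x - y|.
Proof.
elim: n x y => [|n IH] x y; first by rewrite mul1r.
rewrite !zigzag_iterS (le_trans (IH _ _))// exprSr -mulrA.
by rewrite ler_pM2l ?exprn_gt0// zigzag_scaled_lipschitz ?exprn_gt0.
Qed.

Lemma zigzag_iter_step n x :
  `|zigzag_iter n.+1 x - zigzag_iter n x| <= 3 ^+ n / 3 ^+ (n.+1 ^ 2).
Proof.
rewrite zigzag_iterS (le_trans (zigzag_iter_lipschitz _ _ _))//.
by rewrite ler_pM2l ?exprn_gt0// zigzag_scaled_dist_id ?exprn_gt0.
Qed.

(** The innermost factor stretches distances by 3 and sends both points into one cell of its own
    grid, which lies inside a cell of order [n], where the induction hypothesis applies. *)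
Lemma zigzag_iter_expand n k x y :
  k%:~R <= 3 ^+ (n ^ 2).+1 * x <= k%:~R + 1 ->
  k%:~R <= 3 ^+ (n ^ 2).+1 * y <= k%:~R + 1 ->
  `|zigzag_iter n x - zigzag_iter n y| = 3 ^+ n * `|x - y|.
Proof.
elim: n k x y => [|n IH] k x y; first by rewrite mul1r.
have M0 : 0 < 3 ^+ (n.+1 ^ 2) :> R by rewrite exprn_gt0.
rewrite !(exprS _ (n.+1 ^ 2)) !zigzag_iterS => kx ky.
have [j [jx jy]] := zigzag_scaled_cell _ M0 _ _ _ kx ky.
(* The grids are nested because [(n + 1)^2 = 2n + (n^2 + 1)]. *)
have ME : 3 ^+ (n.+1 ^ 2) = (3 ^ n.*2)%:R * 3 ^+ (n ^ 2).+1 :> R.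
  by rewrite natrX -exprD; congr (_ ^+ _); lia.
rewrite {1 3}ME -!mulrA in jx; rewrite {1 3}ME -!mulrA in jy.
have [|l [lx ly]] := coarser_cell _ _ _ _ _ jx jy; first by rewrite expn_gt0.
by rewrite (IH _ _ _ lx ly) (zigzag_scaled_expand _ M0 _ _ _ kx ky) exprSr mulrA.
Qed.

(** Every later scale is an integer multiple of [3 ^+ (n ^ 2).+1], so [x] is a grid point, hence a
    fixed point, of every later factor. *)
Lemma zigzag_iter_grid n m k x : 3 ^+ (n ^ 2).+1 * x = k%:~R ->
  zigzag_iter (n + m) x = zigzag_iter n x.
Proof.
move=> kx; elim: m => [|m IH]; first by rewrite addn0.
rewrite addnS zigzag_iterS.
have M0 : 0 < 3 ^+ ((n + m).+1 ^ 2) :> R by rewrite exprn_gt0.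
rewrite (zigzag_scaled_fix _ M0 (3 ^+ ((n + m).+1 ^ 2 - (n ^ 2).+1) * k))//.
by rewrite intrM -kx mulrA rmorphXn/= -exprD subnK//; nia.
Qed.

End Iterates.

(** * The limit function and its nowhere differentiability *)

Section Limit.
Context {R : realType}.
Implicit Types (x y : R) (k : int) (n m : nat).

Definition zigzag_lim x : R := limn (fun n => zigzag_iter n x).

(** A crude form resting on [2n <= (n + 1)^2]; it makes the telescoping series converge
    absolutely. *)
Lemma zigzag_iter_step_geometric n x :
  `|zigzag_iter n.+1 x - zigzag_iter n x| <= 3^-1 ^+ n.
Proof.
rewrite (le_trans (zigzag_iter_step _ _))// exprVn -ler_pdivlMl ?exprn_gt0//.
rewrite -invfM -exprD lef_pV2 ?posrE ?exprn_gt0// ler_eXn2l ?ltr1n//.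
by nia.
Qed.

Lemma zigzag_iter_cvg x : zigzag_iter n x @[n --> \oo] --> zigzag_lim x.
Proof.
pose u n := zigzag_iter n x.
have cu : cvgn (series (telescope u)).
  apply: normed_cvg.
  apply: (@series_le_cvg _ _ (geometric 1 3^-1)) => [n|n|n|].
  - exact: normr_ge0.
  - by rewrite /geometric/= mul1r exprn_ge0 ?invr_ge0.
  - by rewrite /geometric/= mul1r; exact: zigzag_iter_step_geometric.
  - by apply: is_cvg_geometric_series; rewrite ger0_norm ?invr_ge0//; lra.
suff : cvgn u by [].
rewrite (_ : u = fun n => u 0%N + series (telescope u) n).
  by apply: is_cvgD => //; exact: is_cvg_cst.
by apply/funext => n; exact: eq_sum_telescope.
Qed.

Lemma zigzag_lim_grid n k x : 3 ^+ (n ^ 2).+1 * x = k%:~R ->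
  zigzag_lim x = zigzag_iter n x.
Proof.
move=> kx; apply: cvg_lim => //.
rewrite -(cvg_shiftn n); apply: cvg_near_cst.
by apply: nearW => m /=; rewrite addnC (zigzag_iter_grid _ _ _ _ kx).
Qed.

(** Near [x] the difference quotient is within 1 of the derivative [l], whence [K = |l| + 1]. *)
Lemma derivable_locally_lipschitz (f : R -> R) x : derivable f x 1 ->
  exists K d : R, 0 < d /\
    forall y, `|y - x| < d -> `|f y - f x| <= K * `|y - x|.
Proof.
move=> /cvg_ex[l /cvgrPdist_lt/(_ 1 ltr01)].
rewrite /= /dnbhs => /nbhs_ballP[d /= d0 dP].
exists (`|l| + 1), d; split => // y yd.
have [->|yx] := eqVneq y x; first by rewrite !subrr normr0 mulr0.
have yx0 : y - x != 0 by rewrite subr_eq0.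
have := dP (y - x); rewrite /ball/= sub0r normrN => /(_ yd yx0).
rewrite [_ *: 1]mulr1 subrK => h.
have : `|(y - x)^-1 *: (f y - f x)| <= `|l| + 1.
  rewrite -lerBlDl (le_trans _ (ltW h))// distrC.
  exact: lerB_dist.
by rewrite normrZ normfV ler_pdivrMl ?normr_gt0// mulrC.
Qed.

(* A derivative at [x] would bound the slopes of the chords that straddle [x],
   but the chord over the cell of order [n] around [x] has slope [3 ^+ n]. *)
Lemma zigzag_lim_nowhere_derivable x : ~ derivable zigzag_lim x 1.
Proof.
move=> /derivable_locally_lipschitz[K [d [d0 Kd]]].
(* The two summands make [3 ^+ n] exceed [K] and the cell length [q^-1] drop below [d]. *)
pose n := (Num.bound `|K| + Num.bound d^-1)%N.
have d10 : 0 <= d^-1 by rewrite invr_ge0 ltW.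
have n3n : (n <= 3 ^ n)%N by rewrite ltnW// ltn_expl.
have nK : K < 3 ^+ n.
  rewrite (le_lt_trans (ler_norm K))// (lt_le_trans (archi_boundP (normr_ge0 K)))//.
  rewrite -natrX ler_nat (leq_trans _ n3n)//; exact: leq_addr.
have nd : d^-1 < 3 ^+ (n ^ 2).+1.
  rewrite (lt_le_trans (archi_boundP d10))// -natrX ler_nat.
  rewrite (leq_trans (leq_addl (Num.bound `|K|) _))// -/n (leq_trans n3n)//.
  by rewrite leq_exp2l//; nia.
set q : R := 3 ^+ (n ^ 2).+1 in nd; have q0 : 0 < q by rewrite exprn_gt0.
have qd : q^-1 < d by rewrite -[ltRHS]invrK ltf_pV2 ?posrE ?invr_gt0.
pose k := Num.floor (q * x); have /andP[kx xk] := floor_bounds (q * x).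
pose a := k%:~R / q; pose b := (k + 1)%:~R / q.
have qa : q * a = k%:~R by rewrite mulrC divfK ?gt_eqF.
have qb : q * b = (k + 1)%:~R by rewrite mulrC divfK ?gt_eqF.
have ax : a <= x by rewrite ler_pdivrMr// mulrC.
have xb : x <= b by rewrite ler_pdivlMr// mulrC intrD.
have ba : b - a = q^-1 by rewrite -mulrBl intrD addrAC subrr add0r mul1r.
have exp : `|zigzag_lim b - zigzag_lim a| = 3 ^+ n * q^-1.
  rewrite (zigzag_lim_grid _ _ _ qa) (zigzag_lim_grid _ _ _ qb).
  rewrite (zigzag_iter_expand n k) -/q ?qa ?qb ?ba ?intrD; [|lra|lra].
  by rewrite gtr0_norm ?invr_gt0.
have Kb := Kd b; have Ka := Kd a.
rewrite ger0_norm in Kb; last by lra.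
rewrite ler0_norm in Ka; last by lra.
have {}Kb := Kb ltac:(lra); have {}Ka := Ka ltac:(lra).
(* Triangle inequality through [x]: the bounds on either side add up to [K * (b - a)]. *)
have : 3 ^+ n * q^-1 <= K * q^-1.
  rewrite -exp -ba.
  have := ler_distD (zigzag_lim x) (zigzag_lim b) (zigzag_lim a).
  rewrite (distrC (zigzag_lim x)).
  by lra.
by rewrite ler_pM2r ?invr_gt0// leNgt nK.
Qed.

End Limit.

(** * Hölder continuity for every exponent below 1 *)

Section Hoelder.
Context {R : realType}.
Implicit Types (x y : R) (n m : nat).

Lemma ler_powR_interpolation (a z A B : R) : 0 < a < 1 ->
  0 <= z -> z <= A -> z <= B -> z <= A `^ (1 - a) * B `^ a.
Proof.
move=> /andP[a0 a1] z0 zA zB.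
have -> : z = z `^ (1 - a) * z `^ a.
  by rewrite -powRD ?subrK ?powRr1// oner_eq0.
by apply: ler_pM; rewrite ?powR_ge0// ge0_ler_powR ?nnegrE//; lra.
Qed.

(** Interpolating between the uniform bound [c * w] and the Lipschitz bound [c * |x - y|] gives
    [c * w^(1-a) * |x - y|^a]; the quadratic exponent in [w] beats the factor [3 ^+ n] and leaves
    geometric decay. *)
Lemma zigzag_iter_step_hoelder (a : R) n x y : 0 < a < 1 ->
  `|(zigzag_iter n.+1 x - zigzag_iter n x) -
    (zigzag_iter n.+1 y - zigzag_iter n y)| <=
  4 * 3 `^ (1 - a)^-1 * 3^-1 ^+ n * `|x - y| `^ a.
Proof.
(* The 4 comes from the Lipschitz constants [3 ^+ n.+1 + 3 ^+ n]; the uniform bound [2 * 3 ^+ n * w]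
   is enlarged to match. *)
move=> a01; set w : R := (3 ^+ (n.+1 ^ 2))^-1; set c : R := 4 * 3 ^+ n.
have b0 : 0 < 1 - a by lra.
have w0 : 0 < w by rewrite invr_gt0 exprn_gt0.
have p0 : 0 < 3 ^+ n :> R by rewrite exprn_gt0.
have c0 : 0 < c by rewrite mulr_gt0.
have leA : `|(zigzag_iter n.+1 x - zigzag_iter n x) -
    (zigzag_iter n.+1 y - zigzag_iter n y)| <= c * w.
  rewrite (le_trans (ler_normB _ _))//.
  have := zigzag_iter_step n x; have := zigzag_iter_step n y.
  rewrite -/w /c; have : 0 < 3 ^+ n * w by rewrite mulr_gt0.
  by rewrite -mulrA; lra.
have leB : `|(zigzag_iter n.+1 x - zigzag_iter n x) -
    (zigzag_iter n.+1 y - zigzag_iter n y)| <= c * `|x - y|.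
  have -> : zigzag_iter n.+1 x - zigzag_iter n x -
      (zigzag_iter n.+1 y - zigzag_iter n y) =
    (zigzag_iter n.+1 x - zigzag_iter n.+1 y) -
      (zigzag_iter n x - zigzag_iter n y) by ring.
  rewrite (le_trans (ler_normB _ _))//.
  have := zigzag_iter_lipschitz n.+1 x y; have := zigzag_iter_lipschitz n x y.
  rewrite exprS /c.
  by rewrite -!mulrA; lra.
apply: (le_trans (ler_powR_interpolation a _ _ _ a01 (normr_ge0 _) leA leB)).
rewrite (@powRM _ c w) ?(@powRM _ c `|_|) ?(ltW c0) ?(ltW w0) ?normr_ge0//.
rewrite mulrACA -powRD ?subrK ?oner_eq0// powRr1 ?(ltW c0)// mulrA.
apply: ler_wpM2r; first exact: powR_ge0.
rewrite /c -!mulrA ler_pM2l//.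
have -> : 3^-1 ^+ n = 3 `^ (- n%:R) :> R by rewrite exprVn powRN powR_mulrn.
have -> : w `^ (1 - a) = 3 `^ (- ((n.+1 ^ 2)%:R * (1 - a))).
  by rewrite powRN powRrM powR_mulrn// /w -powR_inv1 ?exprn_ge0// -powRrM mulN1r powRN.
rewrite -powR_mulrn// -!powRD ?pnatr_eq0 ?implybT//.
apply: ler_powR; first by rewrite ler1n.
rewrite natrX -natr1; set s : R := n%:R; move: (1 - a) b0 => b b0.
have s0 : 0 <= s by rewrite ler0n.
have bb : b * b^-1 = 1 by rewrite mulfV ?gt_eqF.
rewrite -(ler_pM2l b0) !mulrDr bb.
(* The exponents, multiplied by [b], require [2sb <= 1 + (s + 1)^2 b^2], which follows by completing
   the square. *)
have := sqr_ge0 ((s + 1) * b - 1).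
by lra.
Qed.

Lemma zigzag_lim_hoelder (a : R) : 0 < a < 1 -> holder_on01 a zigzag_lim.
Proof.
move=> a01; set K : R := 4 * 3 `^ (1 - a)^-1.
have K0 : 0 <= K by rewrite mulr_ge0 ?powR_ge0.
exists (1 + 2 * K) => x y; rewrite !in_itv/= => x01 y01.
set d := `|x - y|; have d1 : d <= 1 by rewrite /d ler_norml; lra.
(* This handles the zeroth composition, the identity, and gives the 1 in the constant. *)
have da : d <= d `^ a.
  have [d0|d0] := ltP 0 d; last by rewrite (le_trans d0) ?powR_ge0.
  rewrite -[leLHS]powRr1 ?normr_ge0//.
  by apply: ger_powR; lra.
have da0 : 0 <= d `^ a by exact: powR_ge0.
(* The deficit [3^-1 ^+ n] closes the induction: its decrease frees [4/3 * K * 3^-1 ^+ n], more than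
   the step costs. *)
have bound n : `|zigzag_iter n x - zigzag_iter n y| <=
    (1 + 2 * K * (1 - 3^-1 ^+ n)) * d `^ a.
  elim: n => [|n IH].
    by rewrite subrr mulr0 addr0 mul1r.
  have := zigzag_iter_step_hoelder a n x y a01; rewrite -/K -/d => step.
  have -> : zigzag_iter n.+1 x - zigzag_iter n.+1 y =
    (zigzag_iter n.+1 x - zigzag_iter n x -
      (zigzag_iter n.+1 y - zigzag_iter n y)) +
    (zigzag_iter n x - zigzag_iter n y) by ring.
  rewrite (le_trans (ler_normD _ _))// (le_trans (lerD step IH))//.
  rewrite -mulrDl ler_wpM2r// exprS.
  have e0 : 0 <= 3^-1 ^+ n :> R by rewrite exprn_ge0 ?invr_ge0.
  have := mulr_ge0 K0 e0.
  by lra.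
have cxy : `|zigzag_iter n x - zigzag_iter n y| @[n --> \oo] -->
    `|zigzag_lim x - zigzag_lim y|.
  by apply: cvg_norm; apply: cvgB; exact: zigzag_iter_cvg.
apply: cvgr_to_le cxy _; apply: nearW => n /=.
rewrite (le_trans (bound n))// ler_wpM2r//.
have e0 : 0 <= 3^-1 ^+ n :> R by rewrite exprn_ge0 ?invr_ge0.
have := mulr_ge0 K0 e0.
by lra.
Qed.

End Hoelder.

(** * Preimages of null sets are null *)

Section Pushforward.
Context {R : realType}.
Implicit Types (x y c d M : R) (j : int) (n m : nat) (A E U : set R).

Local Notation mu := (@lebesgue_measure R).

Lemma lipschitz_measurable (f : R -> R) (K : R) :
  (forall x y, `|f x - f y| <= K * `|x - y|) -> measurable_fun setT f.
Proof.
move=> fK; apply: measurable_realfun.continuous_measurable_fun => x.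
apply/cvgrPdist_le => e e0; near=> y.
apply: (le_trans (fK x y)); have K1 : 0 < `|K| + 1 by have := normr_ge0 K; lra.
have : `|x - y| <= e / (`|K| + 1).
  by near: y; apply: cvgr_dist_le; [exact: cvg_id|exact: divr_gt0].
rewrite ler_pdivlMr// => xy.
have := ler_norm K; have := normr_ge0 (x - y).
by nra.
Unshelve. all: by end_near. Qed.

Lemma measurable_preimage (f : R -> R) A :
  measurable_fun setT f -> measurable A -> measurable (f @^-1` A).
Proof. by move=> mf mA; rewrite -[X in measurable X]setTI; exact: mf. Qed.

Lemma measurable_affine c d :
  measurable_fun setT (fun x => c * x + d).
Proof.
apply: (@lipschitz_measurable _ `|c|) => x y.
by rewrite -normrM mulrBr opprD addrACA subrr addr0.
Qed.

(** By uniqueness of Lebesgue measure: [|c|] times the pushforward agrees with it on half-open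
    intervals, the sign of [c] deciding which end of the preimage is open. *)
Lemma lebesgue_measure_affine c d A : c != 0 -> measurable A ->
  mu ((fun x => c * x + d) @^-1` A) = (`|c|^-1%:E * mu A)%E.
Proof.
move=> c0 mA.
pose g : measurableTypeR R -> measurableTypeR R := fun x => c * x + d.
have mg : measurable_fun setT g by exact: measurable_affine.
have mscaleE : mu A = mscale (NngNum (normr_ge0 c)) (pushforward mu g) A.
  move=> mg'; apply: lebesgue_measure_unique => //= _ [[a b]] _ <-.
  rewrite /mscale/= /pushforward.
  have [c_lt0|c_gt0|/eqP] := ltgtP c 0; last by rewrite (negbTE c0).
  - have -> : g @^-1` `]a, b] = `[(b - d) / c, (a - d) / c[%classic.
      apply/seteqP; split => x; rewrite /= !in_itv/= /g;
        by rewrite ler_ndivrMr// ltr_ndivlMr//; lra.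
    rewrite !lebesgue_measure_itv/= !lte_fin ltr_ndivlMr// divfK// ltrD2r.
    case: ifPn => ab; last by rewrite mule0.
    rewrite -EFinD -EFinM; congr (_%:E).
    by rewrite ltr0_norm// -mulrBl mulrC mulrN divfK//; ring.
  - have -> : g @^-1` `]a, b] = `](a - d) / c, (b - d) / c]%classic.
      apply/seteqP; split => x; rewrite /= !in_itv/= /g;
        by rewrite ltr_pdivrMr// ler_pdivlMr//; lra.
    rewrite !lebesgue_measure_itv/= !lte_fin ltr_pdivrMr// divfK// ltrD2r.
    case: ifPn => ab; last by rewrite mule0.
    rewrite -EFinD -EFinM; congr (_%:E).
    by rewrite gtr0_norm// -mulrBl mulrC divfK//; ring.
by rewrite (mscaleE mg) /mscale/= muleA -EFinM mulVf ?normr_eq0// mul1e.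
Qed.

(** The preimage is covered by those under three affine branches of slope 3 or -3, each contributing
    a third of the measure. *)
Lemma zigzag_scaled_preimage_cell M j E : 0 < M -> measurable E ->
  (mu (`](j%:~R / M)%R, ((j%:~R + 1) / M)%R] `&` zigzag_scaled M @^-1` E) <=
   mu (`](j%:~R / M)%R, ((j%:~R + 1) / M)%R] `&` E))%E.
Proof.
move=> M0 mE; set a := j%:~R / M; set b := (j%:~R + 1) / M.
have mzs : measurable_fun setT (zigzag_scaled M).
  by apply: lipschitz_measurable => x y; exact: zigzag_scaled_lipschitz.
have ab : a <= b by rewrite ler_pM2r ?invr_gt0//; lra.
(* The left end is added because the zigzag returns to it inside the cell, at two thirds; a single
   point is null. *)
set E' := `[a, b] `&` E.
have mE' : measurable E' by exact: measurableI.
have E'le : (mu E' <= mu (`]a, b] `&` E))%E.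
  apply: (@le_trans _ _ (mu ([set a] `|` (`]a, b] `&` E)))).
    apply: le_measure; rewrite ?inE//.
      by apply: measurableU => //; exact: measurableI.
    move=> x [/=]; rewrite in_itv/= => /andP[]; rewrite le_eqVlt.
    move=> /orP[/eqP -> _ _|ax xb Ex]; [by left|right].
    by split => //=; rewrite in_itv/= ax.
  have mI : measurable (`]a, b] `&` E) by exact: measurableI.
  have := measureU2 mu (measurable_set1 a) mI.
  by rewrite /= lebesgue_measure_set1 add0e.
apply: le_trans E'le.
(* The branches of [zigzag_scaled M] on the three thirds, extended to the whole line. *)
pose g0 x : R := 3 * x + - (2 * a).
pose g1 x : R := - 3 * x + (4 * a + 2 / M).
pose g2 x : R := 3 * x + - (2 * b).
have mg c d : measurable ((fun x => c * x + d) @^-1` E').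
  by apply: measurable_preimage => //; exact: measurable_affine.
apply: (@le_trans _ _ (mu (g0 @^-1` E' `|` g1 @^-1` E' `|` g2 @^-1` E'))).
  apply: le_measure; rewrite ?inE.
  - by apply: measurableI => //; exact: measurable_preimage.
  - by apply: measurableU; [apply: measurableU|]; exact: mg.
  move=> x [/=]; rewrite in_itv/= => /andP[ax xb] Ex.
  have Ma : M * a = j%:~R by rewrite mulrC divfK ?gt_eqF.
  have Mb : M * b = j%:~R + 1 by rewrite mulrC divfK ?gt_eqF.
  have jx : j%:~R <= M * x <= j%:~R + 1.
    by rewrite -Mb -Ma !ler_pM2l// xb (ltW ax).
  have E'x : E' (zigzag_scaled M x).
    split => //=; rewrite in_itv/= ler_pdivrMr// ler_pdivlMr// divfK ?gt_eqF//.
    exact: zigzag_unit_cell.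
  have MM : M * M^-1 = 1 by rewrite mulfV ?gt_eqF.
  have zE y : M * y = j%:~R + tooth (M * x - j%:~R) -> y = zigzag_scaled M x.
    by rewrite -zigzagE// => h; rewrite /zigzag_scaled -h mulrC mulKf ?gt_eqF.
  move: zE; rewrite /tooth; case: ifPn => _; last case: ifPn => _; move=> zE.
  - by left; left; rewrite /preimage/= (zE (g0 x))// /g0; lra.
  - by left; right; rewrite /preimage/= (zE (g1 x))// /g1; lra.
  - by right; rewrite /preimage/= (zE (g2 x))// /g2; lra.
have mU := measurableU _ _ (mg 3 (- (2 * a))) (mg (- 3) (4 * a + 2 / M)).
apply: (le_trans (measureU2 mu mU (mg 3 (- (2 * b))))).
apply: (le_trans (leeD (measureU2 mu (mg _ _) (mg _ _)) (lexx _))).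
rewrite /= !lebesgue_measure_affine ?oppr_eq0// normrN ger0_norm//.
rewrite -!ge0_muleDl ?lee_fin ?addr_ge0 ?invr_ge0// -!EFinD.
by rewrite (_ : 3^-1 + 3^-1 + 3^-1 = 1) ?mul1e//; lra.
Qed.

(** Half-open cells are disjoint, so the right-hand sides add up exactly, while the left-hand sides
    are subadditive. *)
Lemma zigzag_scaled_preimage_le M m E : 0 < M -> measurable E ->
  (mu (`]0%R, (m%:R / M)%R] `&` zigzag_scaled M @^-1` E) <=
   mu (`]0%R, (m%:R / M)%R] `&` E))%E.
Proof.
move=> M0 mE; elim: m => [|m IH].
  by rewrite mul0r set_itvoc0 !set0I.
have mzs : measurable_fun setT (zigzag_scaled M).
  by apply: lipschitz_measurable => x y; exact: zigzag_scaled_lipschitz.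
have mzE : measurable (zigzag_scaled M @^-1` E) by exact: measurable_preimage.
have -> : `]0, (m.+1%:R / M)]%classic =
    `]0, (m%:R / M)] `|` `](m%:R / M), (m.+1%:R / M)] :> set R.
  apply: itv_bndbnd_setU; rewrite bnd_simp.
    by rewrite divr_ge0 ?ler0n ?(ltW M0).
  by rewrite ler_pM2r ?invr_gt0// ler_nat.
have mU (i : interval R) A : measurable A -> measurable ([set` i] `&` A).
  by move=> mA; exact: measurableI.
have disj : `]0, (m%:R / M)] `&` E `&`
    (`](m%:R / M), (m.+1%:R / M)] `&` E) = set0.
  by apply/seteqP; split => x //= [[+ _] [+ _]]; rewrite !in_itv/=; lra.
have := measureU mu (mU _ _ mE) (mU _ _ mE) disj.
rewrite /= !setIUl => ->.
apply: (le_trans (measureU2 mu (mU _ _ mzE) (mU _ _ mzE))).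
apply: leeD => //.
by have := zigzag_scaled_preimage_cell _ (m%:Z) _ M0 mE; rewrite -pmulrn natr1.
Qed.

Lemma zigzag_iter_measurable n : measurable_fun setT (@zigzag_iter R n).
Proof. by apply: lipschitz_measurable => x y; exact: zigzag_iter_lipschitz. Qed.

Lemma zigzag_iter_preimage_le n E : measurable E ->
  (mu (`]0%R, 1%R] `&` zigzag_iter n @^-1` E) <= mu (`]0%R, 1%R] `&` E))%E.
Proof.
move=> mE; elim: n => [//|n IH].
apply: le_trans IH.
have M0 : 0 < 3 ^+ (n.+1 ^ 2) :> R by rewrite exprn_gt0.
have mF := measurable_preimage _ _ (zigzag_iter_measurable n) mE.
(* The number of cells equals the scale, so they fill exactly []0, 1]]. *)
have := zigzag_scaled_preimage_le _ (3 ^ (n.+1 ^ 2)) _ M0 mF.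
by rewrite natrX divff ?gt_eqF.
Qed.

Lemma zigzag_lim_measurable : measurable_fun setT (@zigzag_lim R).
Proof.
apply: (@measurable_realfun.measurable_fun_cvg _ _ _ _ zigzag_iter).
  exact: zigzag_iter_measurable.
by move=> x _; exact: zigzag_iter_cvg.
Qed.

(* For open [U], the preimage of [U] under the limit is contained in the limit
   inferior of its preimages under the iterates. *)
Lemma zigzag_lim_preimage_open U : open U ->
  (mu (`]0%R, 1%R] `&` zigzag_lim @^-1` U) <= mu U)%E.
Proof.
move=> oU; have mU : measurable U by exact: measurable_realfun.open_measurable.
pose X n : set R := `]0, 1] `&` zigzag_iter n @^-1` U.
have mX n : measurable (X n).
  apply: measurableI => //; apply: measurable_preimage => //.
  exact: zigzag_iter_measurable.
pose Y m := \bigcap_(n in [set n | (m <= n)%N]) X n.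
have mY m : measurable (Y m) by exact: bigcap_measurableType.
have mUY : measurable (\bigcup_m Y m) by exact: bigcupT_measurable.
apply: (@le_trans _ _ (mu (\bigcup_m Y m))).
  apply: le_measure; rewrite ?inE//.
    apply: measurableI => //; apply: measurable_preimage => //.
    exact: zigzag_lim_measurable.
  move=> x [x01 Ux].
  have /zigzag_iter_cvg[N _ NU] : nbhs (zigzag_lim x) U by exact: open_nbhs_nbhs.
  by exists N => // n Nn; split => //; exact: NU.
have ndY : {homo Y : n m / (n <= m)%N >-> (n <= m)%O}.
  move=> n m nm; apply/subsetPset => x Yx p /= mp.
  by apply: Yx => /=; exact: leq_trans mp.
(* Continuity from below reduces the claim to each [Y m], which lies in [X m]. *)
have cY : mu (Y m) @[m --> \oo] --> mu (\bigcup_m Y m).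
  exact: (@nondecreasing_cvg_mu _ _ _ mu).
apply: cvge_to_le cY _.
apply: nearW => m /=.
apply: (@le_trans _ _ (mu (X m))).
  apply: le_measure; rewrite ?inE; [exact: mY|exact: mX|].
  by move=> x Yx; exact: (Yx m (leqnn m)).
apply: (le_trans (zigzag_iter_preimage_le _ _ mU)).
apply: le_measure; rewrite ?inE; [exact: measurableI|by []|exact: subIsetr].
Qed.

(** Outer regularity encloses [A] in open sets of arbitrarily small measure, to which the bound for
    open sets applies. *)
Lemma zigzag_lim_preimage_null A : measurable A -> mu A = 0%E ->
  mu (`]0%R, 1%R] `&` zigzag_lim @^-1` A) = 0%E.
Proof.
move=> mA A0; apply/eqP; rewrite eq_le measure_ge0 andbT.
apply/lee_addgt0Pr => e e0; rewrite add0e.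
have Afin : (mu A < +oo)%E by rewrite A0 ltry.
have [U [oU AU Ue]] := lebesgue_regularity_outer mA Afin e0.
have mU : measurable U by exact: measurable_realfun.open_measurable.
apply: (@le_trans _ _ (mu (`]0%R, 1%R] `&` zigzag_lim @^-1` U))).
  apply: le_measure; rewrite ?inE.
  - apply: measurableI => //; apply: measurable_preimage => //.
    exact: zigzag_lim_measurable.
  - apply: measurableI => //; apply: measurable_preimage => //.
    exact: zigzag_lim_measurable.
  by apply: setIS => x; exact: AU.
apply: (le_trans (zigzag_lim_preimage_open _ oU)).
have mUA : measurable (U `\` A) by exact: measurableD.
have := measureU2 mu mA mUA; rewrite /= setDUK// A0 add0e => /le_trans; apply.
exact: ltW.
Qed.

End Pushforward.

(** * Failure of the relaxed Sard property *)

Theorem theorem3 (R : realType) :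
  exists f : R -> R,
    (forall alpha : R, 0 < alpha < 1 -> holder_on01 alpha f) /\
    ~ mutually_singular (push_restr f (critical_set f)) (@lebesgue_measure R).
Proof.
exists zigzag_lim; split; first exact: zigzag_lim_hoelder.
move=> [A [mA []]]; rewrite /push_restr => SA CA0.
have SE : critical_set zigzag_lim = `[0, 1]%classic :> set R.
  apply/seteqP; split => [x []//|x x01]; split => //; left.
  exact: zigzag_lim_nowhere_derivable.
have mpre (B : set R) : measurable B -> measurable (zigzag_lim @^-1` B).
  by move=> mB; apply: measurable_preimage mB; exact: zigzag_lim_measurable.
have mI B (i : interval R) : measurable B ->
    measurable ([set` i] `&` zigzag_lim @^-1` B).
  by move=> mB; apply: measurableI => //; exact: mpre.
have mCA : measurable (~` A) by exact: measurableC.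
have C0 := zigzag_lim_preimage_null _ mCA CA0.
rewrite SE in SA.
(* The preimages of [A] and of its complement cover []0, 1]], and both are null there: the first by
   singularity, the second as the preimage of a null set. *)
have : (lebesgue_measure (`]0%R, 1%R] : set R) <= 0 :> \bar R)%E.
  apply: (@le_trans _ _ (lebesgue_measure ((`[0, 1] `&` zigzag_lim @^-1` A) `|`
      (`]0%R, 1%R] `&` zigzag_lim @^-1` (~` A)) : set R))).
    apply: le_measure; rewrite ?inE//.
      by apply: measurableU; apply: mI.
    move=> x x01; have [Ax|Ax] := pselect (A (zigzag_lim x)); [left|right] => //.
    by split => //; apply: subset_itv_oc_cc.
  have := measureU2 (@lebesgue_measure R) (mI _ `[0, 1] mA) (mI _ `]0, 1] mCA).
  by rewrite /= SA C0 adde0.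
by rewrite lebesgue_measure_itv/= lte_fin ltr01 -EFinD subr0 lee_fin ler10.
Qed.
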